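(* For each $n \geq 5$, let $M_n$ be a hyperbolic manifold cover of the Löbell orbifold $\mathbb{H}^3/\Gamma_n$, and suppose that the degrees of the covers $M_n \to \mathbb{H}^3/\Gamma_n$ are finite and uniformly bounded in $n$. Then the systole of $M_n$ approaches $0$ as $n \to \infty$.
   Context: For $n \geq 5$, consider the combinatorial $3$-polyhedron with $2n+2$ faces whose ''top'' and ''bottom'' faces are $n$-gons and whose lateral surface consists of $2n$ pentagons: $n$ upper pentagons $U_i$ and $n$ lower pentagons $V_i$ ($i \in \mathbb{Z}/n$), where $U_i$ is adjacent to the top face, $U_{i\pm 1}$, $V_i$ and $V_{i+1}$, and $V_i$ is adjacent to the bottom face, $V_{i\pm1}$, $U_{i-1}$ and $U_i$. By Andreev's theorem it is realized, uniquely up to isometry, as a compact polyhedron $L_n \subset \mathbb{H}^3$ all of whose dihedral angles are $\pi/2$; this is the Löbell polyhedron $L_n$. Let $\Gamma_n < \mathrm{Isom}(\mathbb{H}^3)$ be the group generated by the reflections in the faces of $L_n$; it is a cocompact lattice, and the quotient $\mathbb{H}^3/\Gamma_n$ is the Löbell orbifold. A manifold cover of $\mathbb{H}^3/\Gamma_n$ of degree $D$ is a quotient $\mathbb{H}^3/\Gamma'$ with $\Gamma' < \Gamma_n$ torsion-free of index $D$. For a lattice $\Gamma < \mathrm{Isom}(\mathbb{H}^d)$, the systole of $\Gamma$, and of $\mathbb{H}^d/\Gamma$, is the minimal translation length of a loxodromic element of $\Gamma$ (an isometry, possibly orientation-reversing, with positive translation length along an invariant axis). *)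

(* Defs.v *)
From HB Require Import structures.
From mathcomp Require Import all_boot all_order all_algebra.
From mathcomp Require Import all_classical all_reals all_analysis.
From mathcomp Require Import ring lra.

Set Implicit Arguments.
Unset Strict Implicit.
Unset Printing Implicit Defensive.

Import Order.TTheory GRing.Theory Num.Theory.
Import numFieldNormedType.Exports.

Local Open Scope classical_set_scope.
Local Open Scope ring_scope.

Section HyperbolicSpace.
Variables (R : realType) (d : nat).
Implicit Types u v w : 'rV[R]_d.+1.

(* Lorentzian form of signature (d, 1); coordinate 0 is the time coordinate. *)
Definition mink u v : R :=
  \sum_(i < d) u 0 (lift ord0 i) * v 0 (lift ord0 i) - u 0 ord0 * v 0 ord0.

(* Upper sheet of the hyperboloid, as a model of H^d. *)
Definition hyp := {x : 'rV[R]_d.+1 | (mink x x == -1) && (0 < x 0 ord0)}.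

Definition arcosh (t : R) : R := ln (t + Num.sqrt (t ^+ 2 - 1)).

Definition hdist (x y : hyp) : R := arcosh (- mink (val x) (val y)).

Definition isometry (g : hyp -> hyp) : Prop :=
  (forall x y, hdist (g x) (g y) = hdist x y) /\ bijective g.

Definition subgroup (G : set (hyp -> hyp)) : Prop :=
  [/\ G `<=` isometry,
      G idfun,
      (forall g h, G g -> G h -> G (g \o h)) &
      (forall g, G g -> exists2 h, G h & cancel g h /\ cancel h g)].

Definition torsion_free (G : set (hyp -> hyp)) : Prop :=
  forall g k, G g -> (0 < k)%N -> iter k g = idfun -> g = idfun.

Definition lcoset (g : hyp -> hyp) (G : set (hyp -> hyp)) : set (hyp -> hyp) :=
  [set g \o h | h in G].

Definition has_index (G H : set (hyp -> hyp)) (k : nat) : Prop :=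
  ([set lcoset g H | g in G] #= `I_k)%card.

(* The quotient of H^d by H is a manifold cover of degree k of the quotient
   of H^d by G. *)
Definition manifold_cover (G H : set (hyp -> hyp)) (k : nat) : Prop :=
  [/\ subgroup H, H `<=` G, torsion_free H & has_index G H k].

Definition geodesic_line (c : R -> hyp) : Prop :=
  forall s t, hdist (c s) (c t) = `|s - t|.

(* g is loxodromic with translation length l (possibly also rotating around or
   reflecting in its axis c). *)
Definition loxodromic (g : hyp -> hyp) (l : R) : Prop :=
  [/\ isometry g, 0 < l &
      exists2 c, geodesic_line c & forall t, g (c t) = c (t + l)].

(* Extended-real valued, so that it is +oo when G has no loxodromic element. *)
Definition systole (G : set (hyp -> hyp)) : \bar R :=
  ereal_inf [set l%:E | l in [set l | exists2 g, G g & loxodromic g l]].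

(* Reflection in the hyperplane orthogonal to the unit spacelike vector e;
   hreflE shows that the default value x of insubd is irrelevant. *)
Definition hrefl (e : 'rV[R]_d.+1) (x : hyp) : hyp :=
  insubd x (val x - (2 * mink (val x) e) *: e).

(* The vectors e f are outward normals of the half-spaces. *)
Definition polyhedron (F : Type) (e : F -> 'rV[R]_d.+1) : set hyp :=
  [set x | forall f, mink (val x) (e f) <= 0].

Definition facet (F : Type) (e : F -> 'rV[R]_d.+1) (f : F) : set hyp :=
  polyhedron e `&` [set x | mink (val x) (e f) = 0].

(* Interior dihedral angle along an edge between two facets with outward unit
   normals u and v. *)
Definition dihedral_angle u v : R := pi - acos (mink u v).

Definition reflection_group (F : Type) (e : F -> 'rV[R]_d.+1) :
    set (hyp -> hyp) :=
  smallest subgroup [set hrefl (e f) | f in setT].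

Lemma minkC u v : mink u v = mink v u.
Proof.
by rewrite /mink mulrC; congr (_ - _); apply: eq_bigr => i _; rewrite mulrC.
Qed.

Lemma minkDl u v w : mink (u + v) w = mink u w + mink v w.
Proof.
rewrite /mink (eq_bigr (fun i => u 0 (lift ord0 i) * w 0 (lift ord0 i) +
  v 0 (lift ord0 i) * w 0 (lift ord0 i))); last first.
  by move=> i _; rewrite mxE mulrDl.
by rewrite big_split /= mxE; ring.
Qed.

Lemma minkZl a u w : mink (a *: u) w = a * mink u w.
Proof.
rewrite /mink (eq_bigr (fun i => a * (u 0 (lift ord0 i) * w 0 (lift ord0 i)))).
  by rewrite -mulr_sumr mxE; ring.
by move=> i _; rewrite mxE mulrA.
Qed.

Lemma minkDr u v w : mink w (u + v) = mink w u + mink w v.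
Proof. by rewrite !(minkC w) minkDl. Qed.

Lemma minkZr a u w : mink w (a *: u) = a * mink w u.
Proof. by rewrite !(minkC w) minkZl. Qed.

Lemma hreflE (e : 'rV[R]_d.+1) (x : hyp) : mink e e = 1 ->
  val (hrefl e x) = val x - (2 * mink (val x) e) *: e.
Proof.
move=> he; rewrite /hrefl; apply: insubdK; rewrite -topredE /=.
case: x => x /= /andP[/eqP xx x0]; rewrite -scaleNr.
set m := mink x e; set y : 'rV[R]_d.+1 := x + _.
have yy : mink y y = -1.
  rewrite /y !(minkDl, minkDr, minkZl, minkZr) xx he (minkC e) -/m; ring.
have xy : mink x y = -1 - 2 * m ^+ 2.
  by rewrite /y minkDr minkZr xx -/m; ring.
clearbody y; apply/andP; split; first by apply/eqP.
rewrite ltNge; apply/negP => y0.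
pose z := (- y 0 ord0) *: x + x 0 ord0 *: y.
have z0 : z 0 ord0 = 0 by rewrite /z !mxE; ring.
have zge : 0 <= mink z z.
  rewrite {1}/mink z0 mul0r subr0; apply: sumr_ge0 => i _.
  by rewrite -expr2 sqr_ge0.
have zE : mink z z =
    - y 0 ord0 ^+ 2 - x 0 ord0 ^+ 2 + 2 * (x 0 ord0 * y 0 ord0) * (1 + 2 * m ^+ 2).
  rewrite /z !(minkDl, minkDr, minkZl, minkZr) xx yy (minkC y x) xy; ring.
have h1 : x 0 ord0 * y 0 ord0 <= 0 by apply: mulr_ge0_le0 => //; exact: ltW.
have h2 : 0 <= m ^+ 2 := sqr_ge0 _.
have h3 : 0 < x 0 ord0 ^+ 2 by rewrite exprn_gt0.
have h4 : 0 <= y 0 ord0 ^+ 2 := sqr_ge0 _.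
have h5 : 2 * (x 0 ord0 * y 0 ord0) * (1 + 2 * m ^+ 2) <= 0.
  by apply: mulr_le0_ge0; lra.
by move: zge; rewrite zE; lra.
Qed.

End HyperbolicSpace.

Inductive lobell_face (n : nat) : Type :=
  | Top
  | Bottom
  | Upper of 'I_n
  | Lower of 'I_n.

Arguments Top {n}.
Arguments Bottom {n}.

(* Indices are cyclic: ordS is the successor modulo n. *)
Definition lobell_adj n (f g : lobell_face n) : bool :=
  match f, g with
  | Top, Upper _ | Upper _, Top | Bottom, Lower _ | Lower _, Bottom => true
  | Upper i, Upper j | Lower i, Lower j => (j == ordS i) || (i == ordS j)
  | Upper i, Lower j | Lower j, Upper i => (j == i) || (j == ordS i)
  | _, _ => false
  end.

(* The outward unit normals e cut out a compact right-angled polyhedron in H^3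
   with the combinatorics of the Loebell polyhedron: every label is an actual
   2-dimensional facet, and two facets share an edge (a set with more than one
   point) exactly when they are combinatorially adjacent.  The adjacency graph
   of the facets determines the face lattice of a 3-dimensional polyhedron. *)
Definition lobell_polyhedron (R : realType) (n : nat)
    (e : lobell_face n -> 'rV[R]_4) : Prop :=
  [/\ (forall f, mink (e f) (e f) = 1),
      compact (val @` polyhedron e) &
      [/\ (exists x : hyp R 3, forall f, mink (val x) (e f) < 0),
          (forall f, exists2 x, facet e f x &
             forall g, g <> f -> mink (val x) (e g) < 0),
          (forall f g, f <> g ->
             lobell_adj f g <->
             exists x y, [/\ x <> y, (facet e f `&` facet e g) x &
                                     (facet e f `&` facet e g) y]) &
          (forall f g, lobell_adj f g -> dihedral_angle (e f) (e g) = pi / 2)]].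

(* Main.v *)
Require Import Defs.
From HB Require Import structures.
From mathcomp Require Import all_boot all_order all_algebra.
From mathcomp Require Import all_classical all_reals all_analysis.
From mathcomp Require Import ring lra.

Set Implicit Arguments.
Unset Strict Implicit.
Unset Printing Implicit Defensive.

Import Order.TTheory GRing.Theory Num.Theory.
Import numFieldNormedType.Exports.

Local Open Scope classical_set_scope.
Local Open Scope ring_scope.

(** The top and bottom faces of the Loebell polyhedron come arbitrarily close to
   each other as n grows, so the product of the reflections in them is a
   loxodromic isometry of small translation length; a bounded power of it
   belongs to the group of the cover.

   In detail, faces without a common edge have ultraparallel planes
   ([nonadjacent_ltN1]), as a consequence of the right dihedral angles. In
   particular the top and bottom planes are at a distance a > 0 with
   [cosh a = c], where - c is the product of their normals. Let p and q be the
   feet of their common perpendicular. The n sides of the top face cannot all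
   stay within bounded distance of p when n is large: in the directions in which
   they are seen from p, the sides at bounded distance are separated by a
   definite angle, because their normals make obtuse or right angles. The same
   holds for q and the bottom face, so for some i both U_i and V_i are far
   away. Since U_i and V_i are orthogonal, this forces c to be close to 1
   ([belt_bound], [lobell_gap]).

   The product g of the two reflections translates the common perpendicular by
   2 a ([reflections_translate]). If the cover has degree k, two of the cosets
   of the powers of g with exponents 0 to k agree, so some power of g with
   exponent m between 1 and k lies in the group of the cover
   ([power_in_cover]). Its translation length 2 m a bounds the systole. *)

(** * Timelike and spacelike vectors *)

Section LorentzGeometry.
Variables (R : realType) (d : nat).
Implicit Types (u v w x y z : 'rV[R]_d.+1) (a b : R).

Lemma minkNl u v : mink (- u) v = - mink u v.
Proof. by rewrite -scaleN1r minkZl mulN1r. Qed.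

Lemma minkNr u v : mink u (- v) = - mink u v.
Proof. by rewrite -scaleN1r minkZr mulN1r. Qed.

Lemma mink0l u : mink 0 u = 0.
Proof. by rewrite -(scale0r 0) minkZl mul0r. Qed.

Definition minkE := (@minkDl R d, @minkDr R d, @minkZl R d, @minkZr R d,
  minkNl, minkNr).

Lemma mink_sum (I : finType) (F : I -> 'rV[R]_d.+1) w :
  mink (\sum_i F i) w = \sum_i mink (F i) w.
Proof.
by elim/big_rec2 : _ => [|i s t _ <-]; rewrite ?mink0l // minkDl.
Qed.

Lemma mink_ge0 u : u 0 ord0 = 0 -> 0 <= mink u u.
Proof.
move=> u0; rewrite /mink u0 mul0r subr0; apply: sumr_ge0 => i _.
by rewrite -expr2 sqr_ge0.
Qed.

Lemma mink_eq0 u : u 0 ord0 = 0 -> mink u u = 0 -> u = 0.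
Proof.
move=> u0; rewrite /mink u0 mul0r subr0 => uu.
apply/rowP => i; rewrite mxE; case: (unliftP ord0 i) => [j ->|->] //.
apply/eqP; rewrite -[_ == _]orbb -mulf_eq0; apply/eqP.
apply: (psumr_eq0P _ uu) => // k _; by rewrite -expr2 sqr_ge0.
Qed.

Let balance u v := v 0 ord0 *: u - u 0 ord0 *: v.

Let balance0 u v : balance u v 0 ord0 = 0.
Proof. by rewrite !mxE mulrC subrr. Qed.

Let balance_mink u v : mink (balance u v) (balance u v) =
  v 0 ord0 ^+ 2 * mink u u - 2 * (u 0 ord0 * v 0 ord0) * mink u v
  + u 0 ord0 ^+ 2 * mink v v.
Proof. by rewrite !minkE (minkC v u); ring. Qed.

Lemma timelike_neq0 u : mink u u < 0 -> u 0 ord0 != 0.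
Proof. by apply: contraTN => /eqP /mink_ge0; rewrite leNgt. Qed.

(** Cancelling the time coordinates of u and v between them leaves a vector of
   nonnegative square; expanding that square gives the sign. This is the
   reversed Cauchy-Schwarz inequality in its weakest useful form. *)
Lemma timelike_mink_sign u v : mink u u < 0 -> mink v v < 0 ->
  u 0 ord0 * v 0 ord0 * mink u v < 0.
Proof.
move=> uu vv; have := mink_ge0 (balance0 u v); rewrite balance_mink.
have := timelike_neq0 uu; rewrite -sqrf_eq0.
have := timelike_neq0 vv; rewrite -sqrf_eq0.
move: (sqr_ge0 (u 0 ord0)) (sqr_ge0 (v 0 ord0)).
rewrite !le_eqVlt => /orP[/eqP <-|u0]; first by rewrite eqxx.
move=> /orP[/eqP <-|v0]; first by rewrite eqxx.
move=> _ _ bal.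
have : v 0 ord0 ^+ 2 * mink u u < 0 by rewrite pmulr_rlt0.
have : u 0 ord0 ^+ 2 * mink v v < 0 by rewrite pmulr_rlt0.
by lra.
Qed.

Definition future u := (mink u u < 0) && (0 < u 0 ord0).

Lemma future_hyp (x : hyp R d) : future (val x).
Proof. by case: x => x /= /andP[/eqP xx x0]; rewrite /future xx x0 ltrN10. Qed.

Lemma hyp_mink (x : hyp R d) : mink (val x) (val x) = -1.
Proof. by case: x => x /= /andP[/eqP]. Qed.

Lemma future_mink u v : future u -> future v -> mink u v < 0.
Proof.
move=> /andP[uu u0] /andP[vv v0].
by have := timelike_mink_sign uu vv; rewrite pmulr_rlt0 // mulr_gt0.
Qed.

Lemma timelike_future u v : future u -> mink v v < 0 -> mink u v < 0 ->
  future v.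
Proof.
move=> /andP[uu u0] vv uv; rewrite /future vv /=.
have := timelike_mink_sign uu vv; rewrite -mulrA pmulr_rlt0 //.
by rewrite nmulr_llt0.
Qed.

Lemma futureZ a u : 0 < a -> future u -> future (a *: u).
Proof.
move=> a0 /andP[uu u0]; rewrite /future !minkE mxE mulr_gt0 // andbT.
by rewrite !pmulr_rlt0.
Qed.

Lemma futureD u v : future u -> future v -> future (u + v).
Proof.
move=> fu fv; have uv := future_mink fu fv.
case/andP: fu => uu u0; case/andP: fv => vv v0.
by rewrite /future !minkE (minkC v u) mxE addr_gt0 // andbT; lra.
Qed.

(** The same cancellation as in [timelike_mink_sign]: the orthogonal complement
   of a timelike vector is positive definite. *)
Lemma orthogonal_timelike_ge0 u w : mink u u < 0 -> mink u w = 0 ->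
  0 <= mink w w.
Proof.
move=> uu uw; have := mink_ge0 (balance0 u w); rewrite balance_mink uw.
have := timelike_neq0 uu; rewrite -sqrf_eq0.
move: (sqr_ge0 (u 0 ord0)) (sqr_ge0 (w 0 ord0)).
rewrite le_eqVlt => /orP[/eqP <-|u0]; first by rewrite eqxx.
move=> w0 _ h; rewrite -(pmulr_rge0 _ u0); nra.
Qed.

Lemma orthogonal_timelike_gt0 u w : mink u u < 0 -> mink u w = 0 -> w != 0 ->
  0 < mink w w.
Proof.
move=> uu uw; apply: contraNT; rewrite -leNgt => ww.
have {}ww : mink w w = 0.
  by apply/eqP; rewrite eq_le ww (orthogonal_timelike_ge0 uu uw).
have := mink_ge0 (balance0 u w); rewrite balance_mink uw ww !mulr0 subr0 addr0.
rewrite nmulr_lge0 // => w0; apply/eqP/mink_eq0 => //.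
by apply/eqP; rewrite -sqrf_eq0 eq_le w0 sqr_ge0.
Qed.

(** Points of H^d are handled below as rays of future vectors, which avoids
   normalizing the results of linear constructions; this lemma converts back. *)
Lemma future_scale w : future w ->
  exists (h : hyp R d) a, 0 < a /\ w = a *: val h.
Proof.
move=> /andP[ww w0]; pose a := Num.sqrt (- mink w w).
have a0 : 0 < a by rewrite sqrtr_gt0 oppr_gt0.
have aa : a ^+ 2 = - mink w w by rewrite sqr_sqrtr // oppr_ge0 ltW.
have h : (mink (a^-1 *: w) (a^-1 *: w) == -1) && (0 < (a^-1 *: w) 0 ord0).
  rewrite mxE mulr_gt0 ?invr_gt0 // andbT !minkE -[mink w w]opprK -aa.
  by apply/eqP; field; rewrite gt_eqF.
exists (exist _ (a^-1 *: w) h), a; split=> //=.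
by rewrite scalerA mulfV ?scale1r // gt_eqF.
Qed.

(** A linear relation, paired with each member of the family, has all its
   coefficients equal to 0. *)
Lemma orthogonal_family_size m (v : 'I_m -> 'rV[R]_d.+1) :
  (forall i j, i != j -> mink (v i) (v j) = 0) ->
  (forall i, mink (v i) (v i) != 0) -> (m <= d.+1)%N.
Proof.
move=> vv v0; pose A := \matrix_i v i.
suff /eqP <- : row_free A by exact: rank_leq_col.
apply: inj_row_free => c cA; apply/rowP => j; rewrite mxE.
have : mink (\sum_i c 0 i *: v i) (v j) = 0.
  suff -> : \sum_i c 0 i *: v i = 0 by rewrite mink0l.
  by rewrite -[RHS]cA mulmx_sum_row; apply: eq_bigr => i _; rewrite rowK.
rewrite mink_sum (bigD1 j) //= big1 ?addr0; last first.
  by move=> i ij; rewrite minkZl vv // mulr0.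
by rewrite minkZl => /eqP; rewrite mulf_eq0 (negPf (v0 j)) orbF => /eqP.
Qed.

End LorentzGeometry.

Section FourDimensions.
Variable (R : realType).
Implicit Types (u v w x y z : 'rV[R]_4) (a b c : R).

(** Three linear conditions on a vector of a 4-dimensional space have a nonzero
   solution; the timelike x makes it spacelike, hence normalizable. *)
Lemma orthogonal_exists x y z : mink x x < 0 ->
  exists d, [/\ mink d d = 1, mink x d = 0, mink y d = 0 & mink z d = 0].
Proof.
move=> xx.
pose g (j : 'I_3) := [:: x; y; z]`_j.
(* The columns of N are x, y, z with the sign of the time coordinate changed, so
   that a row times N lists Lorentz products. *)
pose N := \matrix_(i < 4, j < 3) (if i == ord0 then - g j 0 i else g j 0 i).
have /rowV0Pn[w /sub_kermxP wN w0] : kermx N != 0.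
  rewrite -mxrank_eq0 mxrank_ker subn_eq0 -ltnNge ltnS; exact: rank_leq_col.
have gw j : mink (g j) w = 0.
  move/rowP: wN => /(_ j); rewrite !mxE big_ord_recl mxE eqxx => <-.
  rewrite /mink addrC; congr (_ + _); first by rewrite mulrN mulrC.
  by apply: eq_bigr => i _; rewrite mxE /= mulrC.
have xw : mink x w = 0 by exact: (gw 0).
have ww := orthogonal_timelike_gt0 xx xw w0.
pose a := Num.sqrt (mink w w).
have a0 : 0 < a by rewrite sqrtr_gt0.
have aa : a ^+ 2 = mink w w by rewrite sqr_sqrtr // ltW.
exists (a^-1 *: w); split; rewrite !minkE.
- by rewrite -aa; field; rewrite gt_eqF.
- by rewrite xw mulr0.
- by rewrite (gw 1) mulr0.
- by rewrite (gw 2%:R) mulr0.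
Qed.

(** Subtracting from w its four components leaves a vector orthogonal to the
   frame; were it nonzero, it would complete the frame to five pairwise
   orthogonal anisotropic vectors. *)
Lemma mink_frame (e p f g : 'rV[R]_4) :
  mink e e = 1 -> mink p p = -1 -> mink f f = 1 -> mink g g = 1 ->
  mink e p = 0 -> mink e f = 0 -> mink e g = 0 ->
  mink p f = 0 -> mink p g = 0 -> mink f g = 0 ->
  forall w z, mink w z = mink e w * mink e z - mink p w * mink p z +
    mink f w * mink f z + mink g w * mink g z.
Proof.
move=> ee pp ff gg ep ef eg pf pg fg w z.
pose r := w - (mink e w *: e - mink p w *: p + mink f w *: f + mink g w *: g).
have er : mink e r = 0 by rewrite !minkE ee ep ef eg; ring.
have pr : mink p r = 0 by rewrite !minkE pp (minkC p e) ep pf pg; ring.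
have fr : mink f r = 0 by rewrite !minkE ff (minkC f e) (minkC f p) ef pf fg; ring.
have gr : mink g r = 0 by rewrite !minkE gg (minkC g e) (minkC g p) (minkC g f) eg pg fg; ring.
suff r0 : r = 0.
  by by move: (mink0l z); rewrite -{1}r0 /r !minkE; lra.
apply/eqP/negPn/negP => r0.
have rr : 0 < mink r r by apply: (orthogonal_timelike_gt0 _ pr r0); lra.
pose v (i : 'I_5) := [:: e; p; f; g; r]`_i.
suff : (5 <= 4)%N by [].
apply: (@orthogonal_family_size R 3 5 v).
  case=> [[|[|[|[|[|//]]]]] i5] [[|[|[|[|[|//]]]]] j5] //= _; rewrite /v /= //;
  by rewrite minkC.
case=> [[|[|[|[|[|//]]]]] i5]; rewrite /v /= ?ee ?pp ?ff ?gg ?oppr_eq0 ?oner_eq0 //.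
by rewrite gt_eqF.
Qed.

End FourDimensions.

(** * Nonadjacent faces of right-angled polyhedra *)

Section RightAngledPolyhedron.
Variables (R : realType) (F : finType) (e : F -> 'rV[R]_4).
Implicit Types (w x y z d : 'rV[R]_4) (f g k : F).

Definition share_edge f g : Prop :=
  exists x y : hyp R 3, [/\ x <> y, (facet e f `&` facet e g) x &
                          (facet e f `&` facet e g) y].

Definition in_cone w : Prop := forall k, mink w (e k) <= 0.

Lemma in_cone_scale w (h : hyp R 3) a : 0 < a -> w = a *: val h ->
  in_cone w -> polyhedron e h.
Proof.
move=> a0 -> wP k; have := wP k.
by rewrite minkZl pmulr_rle0.
Qed.

(** Two rays in both facets that are not proportional give two common points. *)
Lemma share_edge_rays f g w w' :
  future w -> future w' -> in_cone w -> in_cone w' ->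
  mink w (e f) = 0 -> mink w (e g) = 0 ->
  mink w' (e f) = 0 -> mink w' (e g) = 0 ->
  (forall a a', 0 < a -> 0 < a' -> a' *: w <> a *: w') ->
  share_edge f g.
Proof.
move=> /future_scale[h [a [a0 wE]]] /future_scale[h' [a' [a'0 w'E]]].
move=> wP w'P wf wg w'f w'g ww'.
have face b (x : hyp R 3) y k : 0 < b -> y = b *: val x -> mink y (e k) = 0 ->
    mink (val x) (e k) = 0.
  by move=> b0 -> /eqP; rewrite minkZl mulf_eq0 gt_eqF //= => /eqP.
have hP := in_cone_scale a0 wE wP; have h'P := in_cone_scale a'0 w'E w'P.
exists h, h'; split; last 2 first.
- by split; (split; [exact: hP|]); exact: (face a _ _ _ a0 wE).
- by split; (split; [exact: h'P|]); exact: (face a' _ _ _ a'0 w'E).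
move=> hh'; apply: (ww' a a' a0 a'0).
by rewrite wE w'E hh' !scalerA mulrC.
Qed.

Lemma strict_shift (A : pred F) z d : (forall k, A k -> mink z (e k) < 0) ->
  exists2 eps, 0 < eps < 1 & forall s, 0 <= s <= eps ->
    forall k, A k -> mink (z + s *: d) (e k) < 0.
Proof.
move=> zA.
suff [eps eps01 epsP] : exists2 eps, 0 < eps < 1 & forall s, 0 <= s <= eps ->
    forall k, k \in enum F -> A k -> mink (z + s *: d) (e k) < 0.
  by exists eps => // s /epsP sP k; apply: sP; rewrite mem_enum.
elim: (enum F) => [|k l [eps /andP[eps0 eps1] epsP]].
  by exists 2^-1 => //; apply/andP; split; lra.
pose b := `|mink d (e k)|.
have [Ak|nAk] := boolP (A k); last first.
  exists eps; first by rewrite eps0.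
  move=> s /epsP sP j; rewrite inE => /orP[/eqP -> Ak|]; last exact: sP.
  by rewrite Ak in nAk.
have zk := zA k Ak.
have b0 : 0 < b + 1 by rewrite ltr_wpDl /b ?normr_ge0.
exists (Num.min eps (- mink z (e k) / (b + 1))).
  by rewrite lt_min gt_min eps0 eps1 divr_gt0 // oppr_gt0.
move=> s /andP[s0]; rewrite le_min => /andP[s1 s2] j.
rewrite inE => /orP[/eqP -> _|jl]; last by apply: epsP => //; rewrite s0.
rewrite !minkE; move: s2; rewrite ler_pdivlMr // mulrDr mulr1.
have : s * mink d (e k) <= s * b by apply: ler_wpM2l => //; exact: ler_norm.
move: s0; rewrite le_eqVlt => /orP[/eqP <-|]; last by lra.
by rewrite !mul0r !addr0.
Qed.

Lemma strict_shift_future z d s : mink z z = -1 -> 0 < z 0 ord0 ->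
  mink z d = 0 -> mink d d = 1 -> 0 <= s < 1 -> future (z + s *: d).
Proof.
move=> zz z0 zd dd /andP[s0 s1].
have fz : future z by rewrite /future zz z0 ltrN10.
by apply: (timelike_future fz); rewrite !minkE ?(minkC d z) zz zd ?dd; nra.
Qed.

(** The constraint attaining the largest ratio is the one by which the ray from
   x towards z enters the polyhedron. *)
Lemma entry_point g k1 x z : mink z (e g) = 0 -> mink x (e g) = 0 ->
  (forall k, k != g -> mink z (e k) < 0) -> 0 < mink x (e k1) ->
  exists k rho, [/\ 0 < rho, 0 < mink x (e k), in_cone (x + rho *: z) &
                    mink (x + rho *: z) (e k) = 0].
Proof.
move=> zg xg zP xk1.
pose r k := mink x (e k) / - mink z (e k).
have k1g : k1 != g by apply: contraTneq xk1 => ->; rewrite xg ltxx.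
case: (@arg_maxP _ _ _ k1 (fun k => k != g) r k1g) => k kg kmax.
have zk := zP k kg.
have rk : 0 < r k.
  by apply: lt_le_trans (kmax _ k1g); rewrite divr_gt0 // oppr_gt0 zP.
have rE j : j != g -> mink x (e j) = - r j * mink z (e j).
  by move=> /zP zj; rewrite /r; field; rewrite lt_eqF.
exists k, (r k); split=> //.
- by rewrite rE //; nra.
- move=> j; have [->|jg] := eqVneq j g; first by rewrite !minkE zg xg mulr0 addr0.
  rewrite !minkE rE // -mulrDl; apply: mulr_ge0_le0; last exact/ltW/zP.
  by rewrite addrC subr_ge0; exact: kmax.
- by rewrite !minkE rE //; ring.
Qed.

Hypothesis unit_normal : forall f, mink (e f) (e f) = 1.
Hypothesis compact_polyhedron : compact (val @` polyhedron e).
Hypothesis interior_point : exists x : hyp R 3, forall f, mink (val x) (e f) < 0.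
Hypothesis proper_facet : forall f, exists2 x, facet e f x &
  forall g, g <> f -> mink (val x) (e g) < 0.
Hypothesis right_angles : forall f g, f <> g -> share_edge f g ->
  mink (e f) (e g) = 0.

Lemma facet_interior_ray f : exists2 z, mink z z = -1 /\ 0 < z 0 ord0 &
  mink z (e f) = 0 /\ forall k, k != f -> mink z (e k) < 0.
Proof.
have [h [_ hf] hP] := proper_facet f; exists (val h).
  by split; [exact: hyp_mink|case/andP: (future_hyp h)].
by split=> // k /eqP; exact: hP.
Qed.

(** In its plane, a facet is cut out by the faces that share an edge with it.
   If x satisfied these constraints and violated another one, the segments from
   x to points z of the relative interior of the facet would all enter the
   facet through faces violated at x. Letting z run through more points than
   there are faces, on a segment orthogonal to x, two of the entry points lie
   on the same face, which therefore shares an edge with the facet. *)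
Lemma facet_cut g x : future x -> mink x (e g) = 0 ->
  (forall k, k <> g -> share_edge g k -> mink x (e k) <= 0) -> in_cone x.
Proof.
move=> fx xg xP k1; rewrite leNgt; apply/negP => xk1.
have [z [zz z0] [zg zP]] := facet_interior_ray g.
have [d [dd zd xd gd]] : exists d, [/\ mink d d = 1, mink z d = 0,
    mink x d = 0 & mink (e g) d = 0].
  by apply: orthogonal_exists; rewrite zz ltrN10.
have [eps /andP[eps0 eps1] epsP] := strict_shift d zP.
pose s (i : 'I_#|F|.+1) : R := eps / i.+1%:R.
have s0 i : 0 < s i by rewrite divr_gt0.
have seps i : s i <= eps by rewrite ler_pdivrMr // ler_peMr ?ler1n ?(ltW eps0).
have s_inj : injective s.
  move=> i j /(mulfI (lt0r_neq0 eps0))/invr_inj/eqP.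
  by rewrite eqr_nat => /eqP[] /val_inj.
pose zs i := z + s i *: d.
have zsg i : mink (zs i) (e g) = 0 by rewrite !minkE zg (minkC d) gd mulr0 addr0.
have fzs i : future (zs i).
  by apply: strict_shift_future => //; rewrite ltW //= (le_lt_trans (seps i)).
have zsP i k : k != g -> mink (zs i) (e k) < 0.
  by apply: epsP; rewrite ltW //=.
have exit i : exists p : F * R, [/\ 0 < p.2, 0 < mink x (e p.1),
    in_cone (x + p.2 *: zs i) & mink (x + p.2 *: zs i) (e p.1) = 0].
  have [k [rho [? ? ? ?]]] := entry_point (zsg i) xg (zsP i) xk1.
  by exists (k, rho).
have [p pP] := choice exit.
have [i [j [ij pij]]] : exists i j, i <> j /\ (p i).1 = (p j).1.
  apply: contrapT => inj.
  suff /leq_card : injective (fun i => (p i).1) by rewrite card_ord ltnn.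
  by move=> i j pij; apply: contrapT => ij; apply: inj; exists i, j.
have [ri xi iP ii] := pP i; have [rj _ jP jj] := pP j.
have fxz i' r : 0 < r -> future (x + r *: zs i').
  by move=> r0; apply: futureD => //; exact: futureZ.
have ki : (p i).1 <> g by move=> kg; move: xi; rewrite kg xg ltxx.
suff : share_edge g (p i).1 by move=> /(xP _ ki); rewrite leNgt xi.
apply: (share_edge_rays (fxz i _ ri) (fxz j _ rj)) => //.
- by rewrite minkDl minkZl xg zsg mulr0 addr0.
- by rewrite minkDl minkZl xg zsg mulr0 addr0.
- by rewrite pij.
move=> a a' a0 a'0 prop; apply: ij; apply: s_inj.
have pd : a' * ((p i).2 * s i) = a * ((p j).2 * s j).
  have /= := congr1 (fun w => mink w d) prop.
  by rewrite !minkE xd zd dd !mulr1 !add0r.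
have prop' v : a' * (mink x v + (p i).2 * mink z v) =
    a * (mink x v + (p j).2 * mink z v).
  have /= := congr1 (fun w => mink w v) prop; rewrite !minkE.
  rewrite !(mulrDr (p _).2) !mulrA !addrA !mulrDr.
  by rewrite !mulrA in pd *; rewrite pd => /addIr.
have zk1 : mink z (e k1) < 0.
  by apply: zP; apply: contraTneq xk1 => ->; rewrite xg ltxx.
have fz : future z by rewrite /future zz z0 ltrN10.
(* Testing the relation against a functional on which x and z have opposite
   signs, and one on which they have the same sign, separates the coefficients. *)
have h1 := prop' (e k1).
have h2 := prop' z; rewrite zz in h2.
have xz := future_mink fx fz.
have e1 : (a' - a) * mink x (e k1) = (a * (p j).2 - a' * (p i).2) * mink z (e k1).
  by lra.
have e2 : (a' - a) * mink x z = - (a * (p j).2 - a' * (p i).2) by lra.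
have aa : (a' - a) * (mink x (e k1) + mink x z * mink z (e k1)) = 0.
  by rewrite mulrDr e1 mulrA e2; ring.
have aE : a' = a.
  apply/eqP; rewrite -subr_eq0; move/eqP: aa; rewrite mulf_eq0.
  case/orP=> // /eqP h; suff : 0 < mink x (e k1) + mink x z * mink z (e k1).
    by rewrite h ltxx.
  by rewrite addr_gt0 // nmulr_lgt0.
rewrite aE subrr mul0r in e2.
have pE : (p i).2 = (p j).2.
  by apply: (mulfI (lt0r_neq0 a0)); rewrite aE in pd; lra.
by move: pd; rewrite aE pE => /(mulfI (lt0r_neq0 a0))/(mulfI (lt0r_neq0 rj)).
Qed.

(** The orthogonal projection to the plane of g of a point in the relative
   interior of f does not change its position with respect to the faces
   orthogonal to g, so by [facet_cut] it lands in the facet g. Being inside the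
   half-space of f it forces a nonpositive product. For product 0 the
   projection stays in the plane of f, and moving the point within f gives a
   second common point of f and g. *)
Lemma nonadjacent_lt0 f g : f <> g -> ~ share_edge f g ->
  mink (e f) (e g) < 0.
Proof.
move=> fg nfg.
have [x [xx x0] [xf xP]] := facet_interior_ray f.
have fx : future x by rewrite /future xx x0 ltrN10.
(* Moving along d preserves the products with the normals of f and g. *)
have [d [dd xd fd gd]] : exists d, [/\ mink d d = 1, mink x d = 0,
    mink (e f) d = 0 & mink (e g) d = 0].
  by apply: orthogonal_exists; rewrite xx ltrN10.
have [eps /andP[eps0 eps1] epsP] := strict_shift d xP.
set m := mink x (e g).
have m0 : m < 0 by apply: xP; apply/eqP => gf; exact: fg.
pose y s := x + s *: d - m *: e g.
have yd s : mink (y s) d = s.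
  by rewrite !minkE xd dd gd; ring.
have ygE s : mink (y s) (e g) = 0.
  by rewrite !minkE (minkC d) gd unit_normal -/m; ring.
have yfE s : mink (y s) (e f) = - m * mink (e f) (e g).
  by rewrite !minkE (minkC d) fd xf (minkC (e g)); ring.
have yF s : 0 <= s <= eps -> future (y s).
  move=> /andP[s0 s1]; apply: (timelike_future fx); last first.
    by rewrite /y !minkE xx xd -/m; nra.
  rewrite {2}/y !(minkDr, minkNr, minkZr) ygE yd.
  rewrite (minkC _ x) /y !minkE xx xd -/m; nra.
have yP s : 0 <= s <= eps -> in_cone (y s).
  move=> sP; apply: (facet_cut (yF s sP) (ygE s)) => k kg gk.
  rewrite /y minkDl minkNl minkZl (right_angles _ gk) ?mulr0 ?subr0; last first.
    by move=> gk'; apply: kg.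
  have [->|kf] := eqVneq k f.
    by rewrite !minkE xf (minkC d) fd mulr0 addr0.
  exact/ltW/epsP.
have zP : 0 <= (0 : R) <= eps by rewrite lexx ltW.
have eP : 0 <= eps <= eps by rewrite lexx ltW.
have le0 : mink (e f) (e g) <= 0.
  by have := yP 0 zP f; rewrite yfE mulNr oppr_le0 nmulr_rge0.
rewrite lt_neqAle le0 andbT; apply/eqP => fg0; apply: nfg.
apply: (share_edge_rays (yF 0 zP) (yF eps eP) (yP 0 zP) (yP eps eP));
  rewrite ?yfE ?fg0 ?ygE ?mulr0 //.
move=> a a' a0 a'0 /(congr1 (fun w => mink w d)) /=; rewrite !minkZl !yd mulr0 => /eqP.
by rewrite eq_sym mulf_eq0 !gt_eqF.
Qed.

Lemma normals_le0 f g : f <> g -> mink (e f) (e g) <= 0.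
Proof.
move=> fg; have [/right_angles ->//|nfg] := pselect (share_edge f g).
exact/ltW/nonadjacent_lt0.
Qed.

Lemma polyhedron_mink_bounded (x : 'rV[R]_4) : exists M,
  forall y : hyp R 3, polyhedron e y -> - mink x (val y) <= M.
Proof.
have [B [_ BP]] := compact_bounded compact_polyhedron.
exists (\sum_(i < 4) `|x 0 i| * (B + 1)) => y yP.
have yB i : `|val y 0 i| <= B + 1.
  have {}BP : `|val y| <= B + 1 by apply: BP; [rewrite ltrDl|exists y].
  apply: le_trans BP; rewrite -[leRHS]/(mx_norm _) mx_normrE.
  exact: (le_bigmax _ (fun ij => `|val y ij.1 ij.2|) (0, i)).
have xy i : `|x 0 i * val y 0 i| <= `|x 0 i| * (B + 1).
  by rewrite normrM ler_wpM2l.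
rewrite /mink opprB [leRHS]big_ord_recl lerD //.
  exact: le_trans (ler_norm _) (xy _).
rewrite -sumrN; apply: ler_sum => i _.
by apply: le_trans (xy _); rewrite -normrN; exact: ler_norm.
Qed.

(** Planes of faces without a common edge are ultraparallel. Since all products
   of normals are nonpositive by [normals_le0], adding nonnegative multiples of
   the normals of f and g to a point keeps it on the right side of every other
   face. If the planes intersect, this includes the projection of an interior
   point to their intersection, and two such projections give an edge. If they
   are tangent at infinity, this includes the translates of an interior point
   by the lightlike vector [e f + e g], and the polyhedron is unbounded. *)
Lemma nonadjacent_ltN1 f g : f <> g -> ~ share_edge f g ->
  mink (e f) (e g) < -1.
Proof.
move=> fg nfg; have c0 := nonadjacent_lt0 fg nfg.
have [h hP] := interior_point.
have xx := hyp_mink h; have fx := future_hyp h.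
set x := val h in hP xx fx.
rewrite ltNge; apply/negP; rewrite le_eqVlt => /orP[/eqP c1|c1].
  pose nu := e f + e g; pose b := - mink x nu.
  have b0 : 0 < b by rewrite oppr_gt0 minkDr; have := hP f; have := hP g; lra.
  have nn : mink nu nu = 0.
    by rewrite /nu !minkE !unit_normal (minkC (e g)) -c1; ring.
  have nuk k : mink nu (e k) <= 0.
    have [->|/eqP kf] := eqVneq k f.
      by rewrite minkDl unit_normal (minkC (e g)) -c1 subrr.
    have [->|/eqP kg] := eqVneq k g.
      by rewrite minkDl unit_normal -c1 addrC subrr.
    have fk : mink (e f) (e k) <= 0 by apply: normals_le0 => ?; apply: kf.
    have gk : mink (e g) (e k) <= 0 by apply: normals_le0 => ?; apply: kg.
    by rewrite minkDl; lra.
  have xnu : mink x nu = - b by rewrite opprK.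
  clearbody b nu.
  have [M MP] := polyhedron_mink_bounded x.
  (* In terms of T = 1 + t * b, boundedness by M reads T ^+ 2 <= M ^+ 2 * (2 * T - 1),
     which fails for T = 1 + 2 * M ^+ 2. *)
  pose t := 2 * M ^+ 2 / b.
  have t0 : 0 <= t by apply: divr_ge0; [rewrite mulr_ge0 ?sqr_ge0|exact: ltW].
  have tb : t * b = 2 * M ^+ 2 by rewrite divfK // gt_eqF.
  have M20 := sqr_ge0 M.
  have fw : future (x + t *: nu).
    by apply: (timelike_future fx); rewrite !minkE ?(minkC nu x) xx ?nn xnu; lra.
  have [y [a [a0 wE]]] := future_scale fw.
  have yP : polyhedron e y.
    apply: (in_cone_scale a0 wE) => k; rewrite !minkE -[0]addr0 lerD //.
      exact: ltW.
    exact: mulr_ge0_le0.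
  have aa : a ^+ 2 = 1 + 2 * (2 * M ^+ 2).
    have := congr1 (fun v => mink v v) wE.
    rewrite !minkE (minkC nu x) xx nn xnu hyp_mink -tb; lra.
  have axy : a * - mink x (val y) = 1 + 2 * M ^+ 2.
    have := congr1 (mink x) wE; rewrite !minkE xx xnu -tb; lra.
  have le1 : 1 + 2 * M ^+ 2 <= a * M by rewrite -axy ler_pM2l //; exact: MP.
  have : (1 + 2 * M ^+ 2) ^+ 2 <= (a * M) ^+ 2.
    by rewrite ler_sqr ?nnegrE //; lra.
  rewrite exprMn aa; nra.
set c := mink (e f) (e g) in c0 c1 *.
have [d [dd xd fd gd]] : exists d, [/\ mink d d = 1, mink x d = 0,
    mink (e f) d = 0 & mink (e g) d = 0].
  by apply: orthogonal_exists; rewrite xx ltrN10.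
have [eps /andP[eps0 eps1] epsP] := @strict_shift predT x d (fun k _ => hP k).
have mf := hP f; have mg := hP g.
set m := mink x (e f) in mf; set n := mink x (e g) in mg.
(* al and be are the coefficients of the projection; D is the Gram determinant
   of the two normals. *)
pose D := 1 - c ^+ 2.
have D0 : 0 < D by rewrite /D; nra.
pose al := (m - c * n) / D; pose be := (n - c * m) / D.
have al0 : al <= 0 by rewrite ler_pdivrMr // mul0r; nra.
have be0 : be <= 0 by rewrite ler_pdivrMr // mul0r; nra.
pose y s := x + s *: d - al *: e f - be *: e g.
have yd s : mink (y s) d = s by rewrite !minkE xd dd fd gd; ring.
have yf s : mink (y s) (e f) = 0.
  rewrite !minkE unit_normal (minkC d) fd (minkC (e g)) -/m -/c /al /be /D.
  by field; rewrite gt_eqF.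
have yg s : mink (y s) (e g) = 0.
  rewrite !minkE unit_normal (minkC d) gd -/n -/c /al /be /D.
  by field; rewrite gt_eqF.
have yF s : 0 <= s <= eps -> future (y s).
  move=> /andP[s0 s1]; apply: (timelike_future fx); last first.
    by rewrite /y !minkE xx xd -/m -/n; nra.
  rewrite {2}/y !(minkDr, minkNr, minkZr) yf yg yd.
  rewrite (minkC _ x) /y !minkE xx xd -/m -/n; nra.
have yP s : 0 <= s <= eps -> in_cone (y s).
  move=> sP k.
  have [->|/eqP kf] := eqVneq k f; first by rewrite yf.
  have [->|/eqP kg] := eqVneq k g; first by rewrite yg.
  have fk : mink (e f) (e k) <= 0 by apply: normals_le0 => ?; apply: kf.
  have gk : mink (e g) (e k) <= 0 by apply: normals_le0 => ?; apply: kg.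
  rewrite /y !(minkDl _ (- _)) !minkNl (minkZl al) (minkZl be).
  by have := epsP s sP k isT; nra.
have zP : 0 <= (0 : R) <= eps by rewrite lexx ltW.
have eP : 0 <= eps <= eps by rewrite lexx ltW.
apply: nfg; apply: (share_edge_rays (yF 0 zP) (yF eps eP) (yP 0 zP) (yP eps eP));
  rewrite ?yf ?yg //.
move=> a a' a0 a'0 /(congr1 (fun w => mink w d)) /=; rewrite !minkZl !yd mulr0 => /eqP.
by rewrite eq_sym mulf_eq0 !gt_eqF.
Qed.

End RightAngledPolyhedron.

(** * Products of two reflections *)

Section HyperbolicFunctions.
Variable R : realType.
Implicit Types s t : R.

Definition cosh t : R := (expR t + expR (- t)) / 2.
Definition sinh t : R := (expR t - expR (- t)) / 2.

Lemma coshN t : cosh (- t) = cosh t.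
Proof. by rewrite /cosh opprK addrC. Qed.

Lemma sinhN t : sinh (- t) = - sinh t.
Proof. by rewrite /sinh opprK; ring. Qed.

Lemma cosh0 : cosh 0 = 1.
Proof. by rewrite /cosh oppr0 expR0; field. Qed.

Lemma cosh_gt0 t : 0 < cosh t.
Proof. by rewrite divr_gt0 // addr_gt0 // expR_gt0. Qed.

Lemma sinh_ge0 t : 0 <= t -> 0 <= sinh t.
Proof.
move=> t0; rewrite divr_ge0 // subr_ge0 ler_expR.
by rewrite (le_trans _ t0) // oppr_le0.
Qed.

Lemma coshD s t : cosh (s + t) = cosh s * cosh t + sinh s * sinh t.
Proof. by rewrite /cosh /sinh opprD !expRD; field. Qed.

Lemma sinhD s t : sinh (s + t) = sinh s * cosh t + cosh s * sinh t.
Proof. by rewrite /cosh /sinh opprD !expRD; field. Qed.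

Lemma cosh2_sinh2 t : cosh t ^+ 2 - sinh t ^+ 2 = 1.
Proof.
by rewrite -cosh0 -(subrr t) coshD coshN sinhN; ring.
Qed.

Lemma arcosh_cosh t : arcosh (cosh t) = `|t|.
Proof.
wlog t0 : t / 0 <= t => [th|].
  case: (leP 0 t) => [/th //|t0].
  by rewrite -coshN -normrN th // oppr_ge0 ltW.
rewrite /arcosh (_ : cosh t ^+ 2 - 1 = sinh t ^+ 2); last first.
  by rewrite -(cosh2_sinh2 t); ring.
rewrite sqrtr_sqr !ger0_norm ?sinh_ge0 //.
by rewrite (_ : cosh t + sinh t = expR t) ?expRK // /cosh /sinh; field.
Qed.

(** The bound on t is [1 + t <= expR t] for [expR t = cosh t + sinh t]. *)
Lemma cosh_sinh_onto c : 1 < c -> exists t,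
  [/\ 0 < t, cosh t = c, sinh t = Num.sqrt (c ^+ 2 - 1) &
      t <= c - 1 + Num.sqrt (c ^+ 2 - 1)].
Proof.
move=> c1; set S := Num.sqrt _.
have c2 : 0 < c ^+ 2 - 1 by rewrite subr_gt0 exprn_egt1.
have S0 : 0 < S by rewrite sqrtr_gt0.
have SS : S ^+ 2 = c ^+ 2 - 1 by rewrite sqr_sqrtr // ltW.
have cS0 : 0 < c + S by lra.
have expt : expR (ln (c + S)) = c + S by rewrite lnK.
have exptN : expR (- ln (c + S)) = c - S.
  rewrite expRN expt; apply: (mulfI (lt0r_neq0 cS0)); rewrite mulfV ?gt_eqF //.
  by rewrite mulrC -subr_sqr SS; ring.
exists (ln (c + S)); split.
- by rewrite ln_gt0 //; lra.
- by rewrite /cosh expt exptN; field.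
- by rewrite /sinh expt exptN; field.
- by have := expR_ge1Dx (ln (c + S)); rewrite expt; lra.
Qed.

End HyperbolicFunctions.

Section ReflectionsInUltraparallelPlanes.
Variables (R : realType) (d : nat).
Implicit Types u v : 'rV[R]_d.+1.

Lemma hreflK u : mink u u = 1 -> involutive (@hrefl R d u).
Proof.
move=> uu x; apply: val_inj; rewrite !hreflE // !minkE uu.
rewrite -addrA -opprD -scalerDl (_ : 2 * mink (val x) u + _ = 0); last by ring.
by rewrite scale0r subr0.
Qed.

(** The axis is the common perpendicular of the planes u and v, which are at
   distance [a = arcosh (- mink u v)]: in arclength from its foot p on u, the
   two reflections act on it by [t |-> - t] and [t |-> - (t + 2 * a)]. The
   point x on the inner side of both planes shows that p lies on the upper
   sheet. *)
Lemma reflections_translate u v (x : hyp R d) :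
  mink u u = 1 -> mink v v = 1 -> mink u v < -1 ->
  mink (val x) u < 0 -> mink (val x) v < 0 ->
  exists l c, [/\ 0 < l, l <= 2 * (- mink u v - 1 + Num.sqrt (mink u v ^+ 2 - 1)),
    geodesic_line c & forall t, (hrefl u \o hrefl v) (c t) = c (t + l)].
Proof.
move=> uu vv; set k := mink u v => k1 xu xv.
have k1' : 1 < - k by rewrite ltrNr.
have [a [a0 ca sa ale]] := cosh_sinh_onto k1'.
rewrite sqrrN in sa ale; set S := Num.sqrt _ in sa ale *.
have S0 : 0 < S by rewrite sqrtr_gt0 subr_gt0 -sqrrN exprn_egt1 //; lra.
have SS : S ^+ 2 = k ^+ 2 - 1.
  by rewrite sqr_sqrtr // subr_ge0 -sqrrN exprn_ege1 //; lra.
(* The foot on the plane u of the common perpendicular. *)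
pose p := S^-1 *: (v - k *: u).
have pu : mink p u = 0 by rewrite !minkE (minkC v) uu -/k; ring.
have pp : mink p p = -1.
  rewrite !minkE (minkC v u) uu vv -/k.
  transitivity ((1 - k ^+ 2) / S ^+ 2); first by field; rewrite gt_eqF.
  by rewrite SS; field; rewrite -SS expf_eq0 gt_eqF.
have vE : v = S *: p + k *: u.
  by rewrite scalerA mulfV ?gt_eqF // scale1r subrK.
have fp : future p.
  apply: (timelike_future (future_hyp x)); first by rewrite pp ltrN10.
  rewrite minkZr pmulr_rlt0 ?invr_gt0 // !minkE; nra.
clearbody p; pose y t := cosh t *: p + sinh t *: u.
have yy s t : mink (y s) (y t) = - cosh (s - t).
  by rewrite !minkE (minkC u) pp pu uu coshD coshN sinhN; ring.
have yP t : (mink (y t) (y t) == -1) && (0 < y t 0 ord0).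
  have yt : mink (y t) (y t) = -1 by rewrite yy subrr cosh0.
  rewrite yt eqxx; suff /andP[] : future (y t) by [].
  apply: (timelike_future fp); first by rewrite yt ltrN10.
  by rewrite !minkE pp pu mulr0 addr0 mulrN1 oppr_lt0 cosh_gt0.
pose c t : hyp R d := exist _ (y t) (yP t).
exists (2 * a), c; split.
- lra.
- by rewrite ler_pM2l.
- by move=> s t; rewrite /hdist /= yy opprK arcosh_cosh.
have up : mink u p = 0 by rewrite minkC.
have yv t : mink (y t) v = - sinh (t + a).
  by rewrite vE !minkE pp pu up uu sinhD ca sa; ring.
have rvy t : val (hrefl v (c t)) = y (- (t + 2 * a)).
  rewrite hreflE //= yv mulrN scaleNr opprK {1}vE /y scalerDr !scalerA addrACA.
  rewrite -!scalerDl coshN sinhN.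
  have -> : t + 2 * a = (t + a) + a by ring.
  have ct : cosh t = cosh (t + a) * cosh a - sinh (t + a) * sinh a.
    by have := coshD (t + a) (- a); rewrite addrK coshN sinhN => ->; ring.
  have st : sinh t = sinh (t + a) * cosh a - cosh (t + a) * sinh a.
    by have := sinhD (t + a) (- a); rewrite addrK coshN sinhN => ->; ring.
  congr (_ *: _ + _ *: _).
    by rewrite (coshD (t + a)) ct -sa; ring.
  by rewrite (sinhD (t + a)) st -[k]opprK -ca; ring.
have ruy t : y t - (2 * mink (y t) u) *: u = y (- t).
  rewrite !minkE pu uu mulr0 add0r mulr1 /y coshN sinhN -addrA -scalerBl.
  by congr (_ + _ *: _); ring.
by move=> t; apply: val_inj; rewrite /= hreflE // rvy ruy opprK.
Qed.

Lemma iter_translate (g : hyp R d -> hyp R d) (c : R -> hyp R d) l m :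
  (forall t, g (c t) = c (t + l)) -> forall t, iter m g (c t) = c (t + m%:R * l).
Proof.
move=> gc t; elim: m => [|m /= ->]; first by rewrite mul0r addr0.
by rewrite gc -addrA -[in RHS]natr1 mulrDl mul1r.
Qed.

End ReflectionsInUltraparallelPlanes.

(** * A bound on the distance of two planes joined by a long belt *)

Section SeparatedPoints.
Variable R : realType.

(** Two points in the same cell of the unit grid are at distance less than
   sqrt 2. The labels b allow two separated families to be counted at once. *)
Lemma separated_size n (A : nat) (b : 'I_n -> bool) (x y : 'I_n -> R) :
  (forall i, `|x i| <= A%:R) -> (forall i, `|y i| <= A%:R) ->
  (forall i j, i != j -> b i = b j ->
     2 <= (x i - x j) ^+ 2 + (y i - y j) ^+ 2) ->
  (n <= 2 * (2 * A).+1 ^ 2)%N.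
Proof.
move=> xA yA sep.
pose cell (r : R) : 'I_(2 * A).+1 := inord (Num.truncn (r + A%:R)).
have cellP (r s : R) : `|r| <= A%:R -> `|s| <= A%:R -> cell r = cell s ->
    `|r - s| < 1.
  move=> rA sA /(congr1 val) /=.
  have trunc_le (t : R) : `|t| <= A%:R -> 0 <= t + A%:R /\
      (Num.truncn (t + A%:R) < (2 * A).+1)%N.
    rewrite ler_norml => /andP[t1 t2]; have t0 : 0 <= t + A%:R by lra.
    split=> //; rewrite ltnS -(ler_nat R) natrM.
    by have /andP[+ _] := truncn_itv t0; lra.
  have [r0 rlt] := trunc_le r rA; have [s0 slt] := trunc_le s sA.
  rewrite !inordK // => e.
  have /andP[r1 r2] := truncn_itv r0; have /andP[s1 s2] := truncn_itv s0.
  by rewrite e -natr1 in r1 r2; rewrite -natr1 in s2; rewrite ltr_norml; lra.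
pose f i := (b i, (cell (x i), cell (y i))).
have f_inj : injective f.
  move=> i j [bij xij yij]; apply/eqP/negPn/negP => ij.
  have := sep i j ij bij.
  have := cellP _ _ (xA i) (xA j) xij; have := cellP _ _ (yA i) (yA j) yij.
  rewrite -(real_normK (num_real (x i - x j))) -(real_normK (num_real (y i - y j))).
  by have := normr_ge0 (x i - x j); have := normr_ge0 (y i - y j); nra.
by have := leq_card f f_inj; rewrite !card_prod card_bool !card_ord.
Qed.

End SeparatedPoints.

Section BeltEstimate.
Variable R : realType.
Implicit Types (u v w a p f g : 'rV[R]_4).

(** Projecting to the plane orthogonal to a and p turns unit vectors that make
   obtuse angles into planar points at distance at least sqrt 2. *)
Lemma obtuse_separated a p f g u w :
  mink a a = 1 -> mink p p = -1 -> mink f f = 1 -> mink g g = 1 ->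
  mink a p = 0 -> mink a f = 0 -> mink a g = 0 ->
  mink p f = 0 -> mink p g = 0 -> mink f g = 0 ->
  mink u u = 1 -> mink w w = 1 -> mink a u = 0 -> mink a w = 0 ->
  mink u w <= 0 ->
  2 <= (mink f u - mink f w) ^+ 2 + (mink g u - mink g w) ^+ 2.
Proof.
move=> aa pp ff gg ap af ag pf pg fg uu ww au aw uw.
have := mink_frame aa pp ff gg ap af ag pf pg fg (u - w) (u - w).
rewrite !minkE (minkC w u) uu ww au aw.
have := sqr_ge0 (mink p u - mink p w); lra.
Qed.

(** Let p and q be the feet of the common perpendicular of the planes e and e',
   and f, g an orthonormal basis of the orthogonal complement of e and e'. In
   the plane of e, the side u i is at distance [arsinh (s i)] from p. Sides
   with [s i <= M] project to points of a bounded part of the f, g plane, which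
   are separated by [obtuse_separated], so their number is bounded in terms of
   M; the same holds for the v i and the distances [arsinh (t i)] from q. Hence
   for large n some i has [M < s i] and [M < t i]. The orthogonality of u i and
   v i reads [c * s i * t i = cos * sqrt (1 + s i ^+ 2) * sqrt (1 + t i ^+ 2)]
   for the angle between the two projections, so c is at most
   [1 + M ^-2]. *)
Lemma belt_bound n M (e e' : 'rV[R]_4) (u v : 'I_n -> 'rV[R]_4) :
  (0 < M)%N -> (2 * (2 * M.+1).+1 ^ 2 < n)%N ->
  mink e e = 1 -> mink e' e' = 1 -> mink e e' < -1 ->
  (forall i, mink (u i) (u i) = 1) -> (forall i, mink (v i) (v i) = 1) ->
  (forall i, mink e (u i) = 0) -> (forall i, mink e' (v i) = 0) ->
  (forall i, mink e' (u i) < 0) -> (forall i, mink e (v i) < 0) ->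
  (forall i, mink (u i) (v i) = 0) ->
  (forall i j, i != j -> mink (u i) (u j) <= 0) ->
  (forall i j, i != j -> mink (v i) (v j) <= 0) ->
  - mink e e' <= 1 + (M%:R ^+ 2)^-1.
Proof.
move=> M0 Mn ee ee' cN uu vv eu e'v e'u ev uv uuN vvN.
set c := - mink e e'; have c1 : 1 < c by rewrite ltrNr.
have eeE : mink e e' = - c by rewrite opprK.
pose S := Num.sqrt (c ^+ 2 - 1).
have c2 : 0 < c ^+ 2 - 1 by rewrite subr_gt0 exprn_egt1.
have S0 : 0 < S by rewrite sqrtr_gt0.
have SS : S ^+ 2 = c ^+ 2 - 1 by rewrite sqr_sqrtr // ltW.
have SN : S != 0 by rewrite gt_eqF.
have [p pE] : exists p, p = S^-1 *: (e' + c *: e) by eexists.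
have [q qE] : exists q, q = S^-1 *: (e + c *: e') by eexists.
have ep : mink e p = 0 by rewrite pE !minkE ee eeE; ring.
have e'q : mink e' q = 0 by rewrite qE !minkE ee' (minkC e') eeE; ring.
have pp : mink p p = -1.
  rewrite pE !minkE (minkC e') ee ee' eeE.
  transitivity ((1 - c ^+ 2) / S ^+ 2); first by field.
  by rewrite SS; field; rewrite gt_eqF.
have qq : mink q q = -1.
  rewrite qE !minkE (minkC e') ee ee' eeE.
  transitivity ((1 - c ^+ 2) / S ^+ 2); first by field.
  by rewrite SS; field; rewrite gt_eqF.
have pz z : mink p z = S^-1 * (mink e' z + c * mink e z) by rewrite pE !minkE.
have qz z : mink q z = S^-1 * (mink e z + c * mink e' z) by rewrite qE !minkE.
have e'z z : mink e z = 0 -> mink p z = 0 -> mink e' z = 0.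
  move=> ez /eqP; rewrite pz ez mulr0 addr0 mulf_eq0 invr_eq0 (negPf SN) /=.
  by move/eqP.
have pt : mink p p < 0 by rewrite pp ltrN10.
have [f [ff pf ef _]] := orthogonal_exists e e pt.
have [g [gg pg eg fg]] := orthogonal_exists e f pt.
have e'f := e'z f ef pf; have e'g := e'z g eg pg.
have qf : mink q f = 0 by rewrite qz ef e'f !mulr0 addr0 mulr0.
have qg : mink q g = 0 by rewrite qz eg e'g !mulr0 addr0 mulr0.
have frame := mink_frame ee pp ff gg ep ef eg pf pg fg.
have frame' := mink_frame ee' qq ff gg e'q e'f e'g qf qg fg.
pose s i := - mink p (u i); pose t i := - mink q (v i).
have s0 i : 0 < s i.
  by rewrite oppr_gt0 pz eu mulr0 addr0 pmulr_rlt0 ?invr_gt0.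
have t0 i : 0 < t i.
  by rewrite oppr_gt0 qz e'v mulr0 addr0 pmulr_rlt0 ?invr_gt0.
have su i : mink f (u i) ^+ 2 + mink g (u i) ^+ 2 = 1 + s i ^+ 2.
  by have := frame (u i) (u i); rewrite uu eu /s; lra.
have tv i : mink f (v i) ^+ 2 + mink g (v i) ^+ 2 = 1 + t i ^+ 2.
  by have := frame' (v i) (v i); rewrite vv e'v /t; lra.
(* The factor c comes from the distance arcosh c between p and q. *)
have cst i : c * s i * t i =
    mink f (u i) * mink f (v i) + mink g (u i) * mink g (v i).
  have := frame (u i) (v i); rewrite uv eu mul0r.
  have -> : mink p (v i) = - (c * t i).
    by rewrite /t pz qz e'v; ring.
  by rewrite /s; lra.
have [i [siM tiM]] : exists i, M%:R < s i /\ M%:R < t i.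
  apply: contrapT => none; move: Mn; rewrite ltnNge => /negP; apply.
  pose b i := s i <= M%:R.
  have bN i : ~~ b i -> t i <= M%:R.
    by rewrite -ltNge => si; rewrite leNgt; apply/negP => ti; apply: none; exists i.
  pose coord z i := if b i then mink z (u i) else mink z (v i).
  have small (x y r : R) : 0 <= r <= M%:R -> x ^+ 2 + y ^+ 2 = 1 + r ^+ 2 ->
      `|x| <= M.+1%:R /\ `|y| <= M.+1%:R.
    move=> /andP[r0 rM] xy; have M1 : 0 <= M%:R :> R by rewrite ler0n.
    have bound (z : R) : z ^+ 2 <= 1 + r ^+ 2 -> `|z| <= M.+1%:R.
      move=> zr; rewrite -ler_sqr ?nnegrE // real_normK ?num_real //.
      by rewrite -natr1; nra.
    by have := sqr_ge0 x; have := sqr_ge0 y; split; apply: bound; lra.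
  have coordP i : `|coord f i| <= M.+1%:R /\ `|coord g i| <= M.+1%:R.
    rewrite /coord; case: ifP => [bi|/negbT/bN ti].
      by apply: (small _ _ (s i)) => //; rewrite ltW.
    by apply: (small _ _ (t i)) => //; rewrite ltW ?ti.
  apply: (@separated_size R n M.+1 b (coord f) (coord g)).
  - by move=> i; case: (coordP i).
  - by move=> i; case: (coordP i).
  move=> i j ij bij; rewrite /coord -bij; case: ifP => _.
    by apply: (obtuse_separated ee pp ff gg ep ef eg) => //; exact: uuN.
  by apply: (obtuse_separated ee' qq ff gg e'q e'f e'g) => //; exact: vvN.
have M1 : 0 < M%:R :> R by rewrite ltr0n.
rewrite leNgt; apply/negP => cM.
have cMM : M%:R ^+ 2 + 1 < c * M%:R ^+ 2.
  have M2 : 0 < M%:R ^+ 2 :> R by rewrite exprn_gt0.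
  by move: cM; rewrite -(ltr_pM2r M2) mulrDl mulVf ?gt_eqF // mul1r.
have big r : M%:R < r -> 1 + r ^+ 2 < c * r ^+ 2.
  move=> Mr; have : M%:R ^+ 2 < r ^+ 2 :> R by rewrite ltr_sqr ?nnegrE // ltW // (lt_trans M1).
  by nra.
have cauchy : (c * s i * t i) ^+ 2 <= (1 + s i ^+ 2) * (1 + t i ^+ 2).
  rewrite cst -su -tv.
  have := sqr_ge0 (mink f (u i) * mink g (v i) - mink g (u i) * mink f (v i)).
  by lra.
have : (1 + s i ^+ 2) * (1 + t i ^+ 2) < (c * s i ^+ 2) * (c * t i ^+ 2).
  by apply: ltr_pM; rewrite ?addr_ge0 ?sqr_ge0 //; exact: big.
by move: cauchy; lra.
Qed.

End BeltEstimate.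

(** * The top and bottom faces of a Loebell polyhedron *)

Section LobellPolyhedra.
Variable R : realType.

(** The common point x makes the span of u and v positive definite, so their
   product is in the range where acos inverts cos. *)
Lemma dihedral_right d (u v : 'rV[R]_d.+1) (x : hyp R d) :
  mink u u = 1 -> mink v v = 1 -> mink (val x) u = 0 -> mink (val x) v = 0 ->
  dihedral_angle u v = pi / 2 -> mink u v = 0.
Proof.
move=> uu vv xu xv; rewrite /dihedral_angle => dih.
have xx : mink (val x) (val x) < 0 by rewrite hyp_mink ltrN10.
have : 0 <= mink (u + v) (u + v).
  by apply: (orthogonal_timelike_ge0 xx); rewrite minkDr xu xv addr0.
have : 0 <= mink (u - v) (u - v).
  by apply: (orthogonal_timelike_ge0 xx); rewrite minkDr minkNr xu xv subr0.
rewrite !minkE (minkC v u) uu vv => h1 h2.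
have acosE : acos (mink u v) = pi / 2 by lra.
rewrite -[LHS]acosK ?acosE ?cos_pihalf //.
by rewrite in_itv /=; apply/andP; split; lra.
Qed.

Section Faces.
Variable n : nat.

Definition face_code (f : lobell_face n) : bool + ('I_n + 'I_n) :=
  match f with
  | Top => inl true
  | Bottom => inl false
  | Upper i => inr (inl i)
  | Lower i => inr (inr i)
  end.

Definition face_decode (c : bool + ('I_n + 'I_n)) : lobell_face n :=
  match c with
  | inl true => Top
  | inl false => Bottom
  | inr (inl i) => Upper i
  | inr (inr i) => Lower i
  end.

Lemma face_codeK : cancel face_code face_decode.
Proof. by case. Qed.

HB.instance Definition _ := Finite.copy (lobell_face n) (can_type face_codeK).

End Faces.

Lemma lobell_normals n (L : lobell_face n -> 'rV[R]_4) : lobell_polyhedron L ->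
  (forall f g, f <> g -> lobell_adj f g -> mink (L f) (L g) = 0) /\
  (forall f g, f <> g -> ~~ lobell_adj f g -> mink (L f) (L g) < -1).
Proof.
move=> [unit cpt [int prop adjP angle]].
have right f g : f <> g -> share_edge L f g -> mink (L f) (L g) = 0.
  move=> fg sfg; have [x [_ [_ [[_ xf] [_ xg]] _]]] := sfg.
  by apply: (dihedral_right _ _ xf xg) => //; apply: angle; exact/adjP.
split=> f g fg; first by move=> /(adjP _ _ fg); exact: right.
move=> /negP nadj; apply: (nonadjacent_ltN1 unit cpt int prop right fg).
by move=> /(adjP _ _ fg).
Qed.

Lemma lobell_gap n M (L : lobell_face n -> 'rV[R]_4) : lobell_polyhedron L ->
  (0 < M)%N -> (2 * (2 * M.+1).+1 ^ 2 < n)%N ->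
  1 < - mink (L Top) (L Bottom) <= 1 + (M%:R ^+ 2)^-1.
Proof.
move=> Lob M0 Mn; have [adj nadj] := lobell_normals Lob.
have le0 f g : f <> g -> mink (L f) (L g) <= 0.
  move=> fg; have [a|a] := boolP (lobell_adj f g); first by rewrite adj.
  by apply: ltW; apply: lt_trans (nadj _ _ fg a) _; rewrite ltrN10.
have lt0 f g : f <> g -> ~~ lobell_adj f g -> mink (L f) (L g) < 0.
  by move=> fg a; apply: lt_trans (nadj _ _ fg a) _; rewrite ltrN10.
have TB : mink (L Top) (L Bottom) < -1 by exact: nadj.
rewrite ltrNr TB /=; case: Lob => unit _ _.
apply: (@belt_bound R n M _ _ (fun i => L (Upper i)) (fun i => L (Lower i))) => //.
- by move=> i; exact: adj.
- by move=> i; exact: adj.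
- by move=> i; exact: lt0.
- by move=> i; exact: lt0.
- by move=> i; apply: adj => //=; rewrite eqxx.
- by move=> i j /eqP ij; apply: le0 => -[].
- by move=> i j /eqP ij; apply: le0 => -[].
Qed.

End LobellPolyhedra.

(** * Systoles of covers *)

Section Covers.
Variables (R : realType) (d : nat).
Implicit Types (g h : hyp R d -> hyp R d) (G H : set (hyp R d -> hyp R d)).

(** Among the k + 1 cosets of the powers of g with exponents 0 to k, two agree. *)
Lemma power_in_cover G H k g : has_index G H k -> H idfun ->
  (forall j, G (iter j g)) -> injective g ->
  exists2 m, (0 < m <= k)%N & H (iter m g).
Proof.
move=> ind H1 Gg g_inj; apply: contrapT => none.
pose f j := lcoset (iter j g) H.
have iter_inj j : injective (iter j g).
  by elim: j => //= j IH x y /g_inj /IH.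
have key i j : (i < j <= k)%N -> f i <> f j.
  move=> /andP[ij jk] fij; apply: none; exists (j - i)%N.
    by rewrite subn_gt0 ij (leq_trans (leq_subr _ _)).
  have [h Hh hE] : f i (iter j g) by rewrite fij; exists idfun.
  suff <- : h = iter (j - i) g by [].
  apply: funext => x; apply: (iter_inj i).
  by rewrite -iterD subnKC ?(ltnW ij) // -hE.
have f_inj : {in `I_k.+1 &, injective f}.
  move=> i j; rewrite !inE /= !ltnS => ik jk fij.
  by case: (ltngtP i j) => // ij; [case: (key i j)|case: (key j i)];
    rewrite ?ij.
have := inj_card_eq f_inj; rewrite card_eq_sym => e1.
have sub : f @` `I_k.+1 `<=` [set lcoset g H | g in G].
  by move=> _ [j _ <-]; exists (iter j g).
have := subset_card_le sub; rewrite (card_le_eqr ind) -(card_le_eql e1).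
by rewrite card_le_II ltnn.
Qed.

Lemma reflection_group_iter (F : Type) (e : F -> 'rV[R]_d.+1) f f' j :
  reflection_group e (iter j (hrefl (e f) \o hrefl (e f'))).
Proof.
move=> K [[_ K1 KM _] Kgen].
have Kr a : K (hrefl (e a)) by apply: Kgen; exists a.
elim: j => [|j IH]; first exact: K1.
by apply: (KM (hrefl (e f) \o hrefl (e f')) _ _ IH); exact: KM.
Qed.

Lemma systole_ge0 G : (0 <= systole G)%E.
Proof.
by apply: le_ereal_inf_tmp => _ [l [g _ [_ l0 _]] <-]; rewrite lee_fin ltW.
Qed.

Lemma systole_le G g l : G g -> loxodromic g l -> (systole G <= l%:E)%E.
Proof. by move=> Gg gl; apply: ereal_inf_lbound; exists l => //; exists g. Qed.

Lemma systole_cover_le (F : Type) (e : F -> 'rV[R]_d.+1) H k f f' :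
  manifold_cover (reflection_group e) H k ->
  (forall a, mink (e a) (e a) = 1) ->
  (exists x : hyp R d, forall a, mink (val x) (e a) < 0) ->
  mink (e f) (e f') < -1 ->
  (systole H <= (k%:R * (2 * (- mink (e f) (e f') - 1 +
     Num.sqrt (mink (e f) (e f') ^+ 2 - 1))))%:E)%E.
Proof.
move=> [[Hiso H1 _ _] _ _ ind] unit [x xP] ff'.
have [l [c [l0 lle cgeo cE]]] :=
  reflections_translate (unit f) (unit f') ff' (xP f) (xP f').
have g_inj : injective (hrefl (e f) \o hrefl (e f')).
  by apply: inj_comp; apply: inv_inj; exact: hreflK.
have [m /andP[m0 mk] Hm] :=
  power_in_cover ind H1 (reflection_group_iter f f') g_inj.
apply: (le_trans (systole_le (l := m%:R * l) Hm _)).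
  split; [exact: Hiso|by rewrite mulr_gt0 // ltr0n|].
  by exists c => // t; exact: iter_translate.
by rewrite lee_fin ler_pM ?ler0n ?(ltW l0) ?ler_nat.
Qed.

End Covers.

Lemma sqrt_gap_le (R : realType) (c : R) M : (0 < M)%N ->
  1 < c <= 1 + (M%:R ^+ 2)^-1 ->
  c - 1 + Num.sqrt (c ^+ 2 - 1) <= 3 / M%:R.
Proof.
move=> M0 /andP[c1]; rewrite -exprVn; set x : R := M%:R^-1 => cx.
have x0 : 0 < x by rewrite invr_gt0 ltr0n.
have x1 : x <= 1 by rewrite invf_le1 ?ltr0n // ler1n.
have : Num.sqrt (c ^+ 2 - 1) <= 2 * x.
  have x2 : x ^+ 2 <= 1 by rewrite exprn_ile1 // ltW.
  have cc : c ^+ 2 - 1 = (c - 1) * (c + 1) by ring.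
  have c2 : (c - 1) * (c + 1) <= x ^+ 2 * 3.
    by apply: ler_pM; lra.
  rewrite -ler_sqr ?nnegrE ?sqrtr_ge0 ?mulr_ge0 ?(ltW x0) //.
  rewrite sqr_sqrtr cc ?mulr_ge0 ?exprMn //; lra.
have : x ^+ 2 <= x by rewrite expr2 ler_piMl // ltW.
by lra.
Qed.

Theorem corollary1p1p2 (R : realType)
    (L : forall n : nat, lobell_face n -> 'rV[R]_4)
    (G : nat -> set (hyp R 3 -> hyp R 3)) (deg : nat -> nat)
    (L_lobell : forall n : nat, (5 <= n)%N -> lobell_polyhedron (L n))
    (G_cover : forall n : nat, (5 <= n)%N ->
       manifold_cover (reflection_group (L n)) (G n) (deg n))
    (deg_bounded : exists D : nat, forall n : nat, (5 <= n)%N ->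
       (deg n <= D)%N) :
  (fun n : nat => systole (G n)) @ \oo --> 0%E.
Proof.
have [D degD] := deg_bounded.
have small eps : 0 < eps -> \forall n \near \oo, (systole (G n) <= eps%:E)%E.
  move=> eps0; pose M := (Num.truncn (6 * D%:R / eps)).+1.
  have Meps : 6 * D%:R / M%:R <= eps.
    rewrite ler_pdivrMr ?ltr0n // [leRHS]mulrC -ler_pdivrMr //.
    have : 0 <= 6 * D%:R / eps by rewrite divr_ge0 ?mulr_ge0 ?ler0n // ltW.
    by move=> /truncn_itv/andP[_ /ltW].
  near=> n.
  have n5 : (5 <= n)%N by near: n; exact: nbhs_infty_ge.
  have Mn : (2 * (2 * M.+1).+1 ^ 2 < n)%N by near: n; exact: nbhs_infty_gt.
  have Lob := L_lobell n n5; have gap := lobell_gap Lob (ltn0Sn _) Mn.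
  have := sqrt_gap_le (ltn0Sn _) gap; rewrite sqrrN => gap3.
  case: Lob => unit _ [int _ _ _]; have /andP[c1 _] := gap.
  have TB : mink (L n Top) (L n Bottom) < -1 by rewrite -ltrNr.
  apply: (le_trans (systole_cover_le (G_cover n n5) unit int TB)).
  rewrite lee_fin; apply: le_trans Meps.
  have degn : (deg n)%:R <= D%:R :> R by rewrite ler_nat degD.
  have -> : 6 * D%:R / M%:R = D%:R * (2 * (3 / M%:R)) :> R by ring.
  apply: ler_pM; rewrite ?ler0n ?ler_pM2l //.
  by rewrite mulr_ge0 // addr_ge0 ?sqrtr_ge0 // subr_ge0 ltW.
apply/fine_cvgP; split.
  near=> n; have le1 : (systole (G n) <= 1%:E)%E by near: n; exact: small.
  by have := systole_ge0 (G n); case: (systole (G n)) le1.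
apply/cvgrPdist_le => eps eps0; near=> n; rewrite sub0r normrN.
have le_eps : (systole (G n) <= eps%:E)%E by near: n; exact: small.
have := systole_ge0 (G n); rewrite /=.
case: (systole (G n)) le_eps => //= r; rewrite !lee_fin => rle r0.
by rewrite ger0_norm.
Unshelve. all: by end_near.
Qed.
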